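(* Let $\Sigma=\{u\in\mathbb R^2:u_2=0\}$, $u^\pm=(u_1^\pm,u_2^\pm)$ with $u_2^+>0>u_2^-$, and $$Q^\pm=\begin{pmatrix}a_\pm&c_\pm\\c_\pm&b_\pm\end{pmatrix},\qquad a_-,b_->0,\quad a_+,b_+<0,\quad \det Q^\pm=a_\pm b_\pm-c_\pm^2>0.$$ Let $f(u)=Q^-(u-u^-)$ for $u_2<0$ and $f(u)=Q^+(u-u^+)$ for $u_2>0$. Put $$\Lambda(u^-,u^+)=A_1(u_1^+-u_1^-)+A_2(u_2^+-u_2^-),$$ $$A_1=c_-\det Q^+-c_+\det Q^-,\qquad A_2=b_-\det Q^+-b_+\det Q^-.$$ If $\Lambda(u^-,u^+)<0$, then for every heteroclinic $\gamma_s$ of $u'=f(u)$ joining $u^-$ to $u^+$ and crossing $\Sigma$ transversally at $\gamma_s(0)=w=(s,0)$, the spectral problem associated with $\gamma_s$ has a real eigenvalue $\lambda>0$; hence the shock is spectrally unstable.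
   Context: Transversal crossing means $\hat f_2^\pm>0$, where $\hat f^\pm=Q^\pm(w-u^\pm)$; also $\gamma_s(\xi)\in\{\pm u_2>0\}$ for $\pm\xi>0$. Let $\mathbf n=(0,1)$ and $Sv=v+(\hat f^+-\hat f^-)\dfrac{\langle v,\mathbf n\rangle}{\langle\hat f^-,\mathbf n\rangle}$. A number $\lambda\in\mathbb C$ is an eigenvalue of the spectral problem associated with $\gamma_s$ if there is a not identically zero pair $(v,z)$ with values in $\mathbb C^2\times\mathbb C^2$, smooth on $(-\infty,0]$ and on $[0,\infty)$ (with one-sided limits at $0$), such that $v'=Q^\pm v+z$, $z'=\lambda v$ for $\pm\xi>0$, $v(+0)=Sv(-0)$, $z(+0)=z(-0)$, and $v,z\to0$ as $\xi\to\pm\infty$. Spectral instability means existence of an eigenvalue with $\operatorname{Re}\lambda>0$. *)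

(* Defs.v *)
From Stdlib Require Import Reals.
From Coquelicot Require Import Coquelicot.

Open Scope R_scope.

Definition R2 : NormedModule R_AbsRing :=
  prod_NormedModule R_AbsRing R_NormedModule R_NormedModule.

(** [C^2] as a real normed space, for derivatives and limits in a real variable. *)
Definition C2 : NormedModule R_AbsRing :=
  prod_NormedModule R_AbsRing C_R_NormedModule C_R_NormedModule.

(** The real symmetric matrix with rows [(a, c)] and [(c, b)]. *)
Record sym2 : Type := Sym2 { ent_a : R; ent_b : R; ent_c : R }.

Definition det (Q : sym2) : R := ent_a Q * ent_b Q - ent_c Q ^ 2.

(** The next definitions are generic in [V] so that they apply to real vectors
    ([V = R]) as well as to complex ones ([V = C]). *)
Definition mulsv {V : NormedModule R_AbsRing} (Q : sym2) (x : V * V) : V * V :=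
  (plus (scal (ent_a Q) (fst x)) (scal (ent_c Q) (snd x)),
   plus (scal (ent_c Q) (fst x)) (scal (ent_b Q) (snd x))).

Definition dot {V : NormedModule R_AbsRing} (x : V * V) (m : R * R) : V :=
  plus (scal (fst m) (fst x)) (scal (snd m) (snd x)).

Definition normal : R2 := (0, 1).

(** [dir y k] is the real vector [y] multiplied by the scalar [k]. *)
Definition dir {V : NormedModule R_AbsRing} (y : R * R) (k : V) : V * V :=
  (scal (fst y) k, scal (snd y) k).

Definition affine_field (Q : sym2) (ueq : R2) (u : R2) : R2 :=
  mulsv Q (minus u ueq).

(** The field is left undefined on the line [u_2 = 0] in the mathematics;
    the value chosen here on that line is never used (see [heteroclinic]). *)
Definition field (Qm Qp : sym2) (um up : R2) (u : R2) : R2 :=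
  if Rlt_dec (snd u) 0 then affine_field Qm um u else affine_field Qp up u.

(** Continuous orbits, satisfying the equation off the discontinuity line. *)
Definition heteroclinic (Qm Qp : sym2) (um up : R2) (g : R -> R2) : Prop :=
  (forall xi : R, continuous g xi) /\
  (forall xi : R, snd (g xi) <> 0 ->
     is_derive g xi (field Qm Qp um up (g xi))) /\
  filterlim g (Rbar_locally m_infty) (locally um) /\
  filterlim g (Rbar_locally p_infty) (locally up).

Definition crosses_transversally (Qm Qp : sym2) (um up : R2) (g : R -> R2)
    (w : R2) : Prop :=
  g 0 = w /\
  (forall xi : R, xi < 0 -> snd (g xi) < 0) /\
  (forall xi : R, 0 < xi -> 0 < snd (g xi)) /\
  0 < snd (affine_field Qm um w) /\
  0 < snd (affine_field Qp up w).

(** The matrix [S], built from the one-sided field values [fm], [fp]. *)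
Definition jump (fm fp : R2) (v : C2) : C2 :=
  plus v (dir (minus fp fm)
            (scal (/ dot (V := R_NormedModule) fm normal)
                  (dot (V := C_R_NormedModule) v normal))).

(** For [I] an open half-line ending at [0]: the restriction of [g] to [I] is
    smooth on the closed half-line, i.e. derivatives of all orders exist on [I]
    and have limits at [0] from within [I]. The value [g 0] plays no role. *)
Definition smooth_up_to_zero {V : NormedModule R_AbsRing} (I : R -> Prop)
    (g : R -> V) : Prop :=
  exists D : nat -> R -> V,
    (forall x : R, I x -> D O x = g x) /\
    (forall (k : nat) (x : R), I x -> is_derive (D k) x (D (S k) x)) /\
    (forall k : nat, exists l : V,
       filterlim (D k) (within I (locally 0)) (locally l)).

Definition spectral_ode (Q : sym2) (lam : C) (v z : R -> C2) (xi : R) : Prop :=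
  is_derive v xi (plus (mulsv Q (v xi) : C2) (z xi)) /\
  is_derive z xi ((Cmult lam (fst (v xi)), Cmult lam (snd (v xi))) : C2).

(** Two-sided functions represent the pair; values at [0] play no role, whence
    the restriction [xi <> 0] in the nontriviality condition. *)
Definition is_eigenvalue (Qm Qp : sym2) (um up : R2) (w : R2) (lam : C) : Prop :=
  exists v z : R -> C2,
    (exists xi : R, xi <> 0 /\ (v xi <> zero \/ z xi <> zero)) /\
    smooth_up_to_zero (fun xi => xi < 0) v /\
    smooth_up_to_zero (fun xi => 0 < xi) v /\
    smooth_up_to_zero (fun xi => xi < 0) z /\
    smooth_up_to_zero (fun xi => 0 < xi) z /\
    (forall xi : R, xi < 0 -> spectral_ode Qm lam v z xi) /\
    (forall xi : R, 0 < xi -> spectral_ode Qp lam v z xi) /\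
    (exists vl : C2,
       filterlim v (at_left 0) (locally vl) /\
       filterlim v (at_right 0)
         (locally (jump (affine_field Qm um w) (affine_field Qp up w) vl))) /\
    (exists z0 : C2,
       filterlim z (at_left 0) (locally z0) /\
       filterlim z (at_right 0) (locally z0)) /\
    filterlim v (Rbar_locally m_infty) (locally (zero : C2)) /\
    filterlim v (Rbar_locally p_infty) (locally (zero : C2)) /\
    filterlim z (Rbar_locally m_infty) (locally (zero : C2)) /\
    filterlim z (Rbar_locally p_infty) (locally (zero : C2)).

Definition spectrally_unstable (Qm Qp : sym2) (um up : R2) (w : R2) : Prop :=
  exists lam : C, 0 < Re lam /\ is_eigenvalue Qm Qp um up w lam.

Definition A1 (Qm Qp : sym2) : R := ent_c Qm * det Qp - ent_c Qp * det Qm.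

Definition A2 (Qm Qp : sym2) : R := ent_b Qm * det Qp - ent_b Qp * det Qm.

Definition Lambda (Qm Qp : sym2) (um up : R2) : R :=
  A1 Qm Qp * (fst up - fst um) + A2 Qm Qp * (snd up - snd um).

(* Main.v *)
(** For [lam > 0] the solutions decaying at [-oo] (resp. [+oo]) are
    [v = exp (xi K) v0], [z = lam K^-1 v] with [K^2 = Q K + lam] and [K] positive
    (resp. negative) definite. The matching conditions at [0] have a nonzero
    solution iff the Evans function [det (K_-^-1 - K_+^-1 S)] vanishes. As
    [lam -> +oo] it has the sign of [det (1 + S) > 0] by transversality, and at
    [lam = 0] it equals [det (Q_-^-1 - Q_+^-1 S)], a positive multiple of
    [Lambda], hence is negative; so it vanishes for some [lam > 0]. *)

Require Import Defs.
From Stdlib Require Import Reals Lra.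
From Coquelicot Require Import Coquelicot.

Open Scope R_scope.

(** * Linear algebra of real symmetric 2x2 matrices *)

Lemma singular_kernel (m11 m12 m21 m22 : R) :
  m11 * m22 - m12 * m21 = 0 ->
  exists p1 p2 : R, (p1 <> 0 \/ p2 <> 0) /\
    m11 * p1 + m12 * p2 = 0 /\ m21 * p1 + m22 * p2 = 0.
Proof.
intros Hdet.
(* A vector orthogonal to a nonzero row is annihilated by the other row as well, because the
   determinant vanishes. *)
destruct (Req_dec m11 0) as [H11|H11].
- destruct (Req_dec m12 0) as [H12|H12].
  + destruct (Req_dec m21 0) as [H21|H21].
    * exists 1, 0; repeat split; subst; lra.
    * exists (- m22), m21; repeat split; subst; try lra; right; lra.
  + exists (- m12), m11; repeat split; try lra; left; lra.
- exists (- m12), m11; repeat split; try lra; right; lra.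
Qed.

(** The symmetric matrix with eigenvalue [q1] on [(x, y)] and [q2] on
    [(-y, x)], when [x^2 + y^2 = 1]. *)
Definition spec (q1 q2 x y : R) : sym2 :=
  Sym2 (q1 * x ^ 2 + q2 * y ^ 2) (q1 * y ^ 2 + q2 * x ^ 2)
    ((q1 - q2) * x * y).

Lemma spec_same (q x y : R) : x ^ 2 + y ^ 2 = 1 -> spec q q x y = Sym2 q q 0.
Proof.
intros H; unfold spec; f_equal; try ring; rewrite <- (Rmult_1_r q) at 3;
  rewrite <- H; ring.
Qed.

Lemma det_spec (q1 q2 x y : R) :
  x ^ 2 + y ^ 2 = 1 -> det (spec q1 q2 x y) = q1 * q2.
Proof.
intros H.
replace (q1 * q2) with (q1 * q2 * (x ^ 2 + y ^ 2) ^ 2) by (rewrite H; ring).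
unfold det, spec; simpl; ring.
Qed.

Lemma sym2_diagonalization (Q : sym2) :
  exists q1 q2 x y : R, x ^ 2 + y ^ 2 = 1 /\ Q = spec q1 q2 x y.
Proof.
destruct Q as [a b c].
destruct (Req_dec c 0) as [Hc|Hc].
  exists a, b, 1, 0; split; [ring | subst c; unfold spec; f_equal; ring].
set (r := sqrt ((a - b) ^ 2 + 4 * c ^ 2)).
assert (Hc2 : 0 < c ^ 2) by (apply pow2_gt_0; exact Hc).
assert (Hab : 0 <= (a - b) ^ 2) by apply pow2_ge_0.
assert (Hr : r ^ 2 = (a - b) ^ 2 + 4 * c ^ 2).
{ unfold r; rewrite pow2_sqrt; [reflexivity | lra]. }
(* [a + d] is the larger root of the characteristic polynomial and [(c, d)] an eigenvector for it,
   by the quadratic equation [Hd]; the trace leaves [b - d] as the other eigenvalue, and [m]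
   normalises the eigenvector. *)
set (d := (b - a + r) / 2).
assert (Hd : d ^ 2 = (b - a) * d + c ^ 2) by (unfold d; nra).
assert (Hd2 : 0 <= d ^ 2) by apply pow2_ge_0.
set (m := sqrt (c ^ 2 + d ^ 2)).
assert (Hm : m ^ 2 = c ^ 2 + d ^ 2).
{ unfold m; rewrite pow2_sqrt; [reflexivity | lra]. }
assert (Hm0 : m <> 0) by (intro E; rewrite E in Hm; lra).
assert (Hcd : c ^ 2 + d ^ 2 <> 0) by lra.
exists (a + d), (b - d), (c / m), (d / m); split.
{ replace ((c / m) ^ 2 + (d / m) ^ 2) with ((c ^ 2 + d ^ 2) / m ^ 2)
    by (field; exact Hm0).
  rewrite Hm; apply Rdiv_diag, Hcd. }
unfold spec; f_equal.
- replace ((a + d) * (c / m) ^ 2 + (b - d) * (d / m) ^ 2)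
    with (((a + d) * c ^ 2 + (b - d) * d ^ 2) / m ^ 2) by (field; exact Hm0).
  rewrite Hm; field_simplify_eq; [|exact Hcd].
  enough (d * (d ^ 2 - (b - a) * d - c ^ 2) = 0) by lra.
  rewrite Hd; ring.
- replace ((a + d) * (d / m) ^ 2 + (b - d) * (c / m) ^ 2)
    with (((a + d) * d ^ 2 + (b - d) * c ^ 2) / m ^ 2) by (field; exact Hm0).
  rewrite Hm; field_simplify_eq; [|exact Hcd].
  enough ((- d) * (d ^ 2 - (b - a) * d - c ^ 2) = 0) by lra.
  rewrite Hd; ring.
- replace ((a + d - (b - d)) * (c / m) * (d / m))
    with (c * (d * (a - b) + 2 * d ^ 2) / m ^ 2) by (field; exact Hm0).
  rewrite Hm; field_simplify_eq; [|exact Hcd].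
  enough (c * (d ^ 2 - (b - a) * d - c ^ 2) = 0) by lra.
  rewrite Hd; ring.
Qed.

(** The determinant is [q1 * q2], so the eigenvalues share a sign; the positive diagonal entry, a
    convex combination of them, decides which. *)
Lemma spec_pos (q1 q2 x y : R) :
  x ^ 2 + y ^ 2 = 1 -> 0 < ent_a (spec q1 q2 x y) ->
  0 < det (spec q1 q2 x y) -> 0 < q1 /\ 0 < q2.
Proof.
intros H Ha Hd; rewrite (det_spec _ _ _ _ H) in Hd; simpl in Ha.
assert (Hx : 0 <= x ^ 2) by apply pow2_ge_0.
assert (Hy : 0 <= y ^ 2) by apply pow2_ge_0.
destruct (Rlt_dec 0 q1) as [H1|H1]; destruct (Rlt_dec 0 q2) as [H2|H2]; nra.
Qed.

(** * Spatial decay rates along the compactified spectral parameter *)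

(** With [lam = (t / (1 - t))^2], [rate q t / (1 - t)] is the positive root of
    [k^2 = q k + lam]; the parameter [t] compactifies [0 <= lam <= +oo] so that
    the rescaled Evans determinant has finite values at both ends. *)
Definition rate (q t : R) : R :=
  (q * (1 - t) + sqrt ((q * (1 - t)) ^ 2 + 4 * t ^ 2)) / 2.

Lemma rate_radicand_pos (q t : R) :
  0 < q -> 0 < (q * (1 - t)) ^ 2 + 4 * t ^ 2.
Proof.
intros Hq; destruct (Req_dec t 0) as [->|Ht].
- assert (0 < q * (1 - 0)) by lra; nra.
- assert (0 < t ^ 2) by (apply pow2_gt_0; exact Ht).
  assert (0 <= (q * (1 - t)) ^ 2) by apply pow2_ge_0; lra.
Qed.

Lemma rate_eq (q t : R) :
  0 < q -> rate q t ^ 2 = q * (1 - t) * rate q t + t ^ 2.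
Proof.
intros Hq; unfold rate.
assert (H := rate_radicand_pos q t Hq).
assert (Hs := pow2_sqrt _ (Rlt_le _ _ H)).
set (r := sqrt _) in *; nra.
Qed.

Lemma rate_pos (q t : R) : 0 < q -> 0 < rate q t.
Proof.
intros Hq; unfold rate.
assert (H := rate_radicand_pos q t Hq).
assert (Hs := pow2_sqrt _ (Rlt_le _ _ H)).
assert (Hs0 := sqrt_lt_R0 _ H).
set (r := sqrt _) in *.
(* For [t <> 0] the radicand exceeds [(q * (1 - t)) ^ 2], so the root dominates even where [1 - t]
   is negative. *)
destruct (Req_dec t 0) as [->|Ht]; [nra|].
assert (0 < t ^ 2) by (apply pow2_gt_0; exact Ht).
assert (- r < q * (1 - t)) by nra; lra.
Qed.

Lemma rate_0 (q : R) : 0 < q -> rate q 0 = q.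
Proof.
intros Hq; unfold rate.
replace ((q * (1 - 0)) ^ 2 + 4 * 0 ^ 2) with (q ^ 2) by ring.
rewrite sqrt_pow2; lra.
Qed.

Lemma rate_1 (q : R) : rate q 1 = 1.
Proof.
unfold rate.
replace ((q * (1 - 1)) ^ 2 + 4 * 1 ^ 2) with (2 ^ 2) by ring.
rewrite sqrt_pow2; lra.
Qed.

(** Radicand and rate are positive for every real [t], not only on [0, 1]; the Evans function is
    thus continuous on the whole line, as [IVT] demands. *)
Lemma ex_derive_inv_rate (q t : R) :
  0 < q -> ex_derive (fun t => / rate q t) t.
Proof.
intros Hq.
assert (H := rate_radicand_pos q t Hq).
assert (H' := rate_pos q t Hq).
unfold rate in *; auto_derive; repeat split; simpl in *; try lra.
apply Rgt_not_eq; exact H'.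
Qed.

(** * Two-mode exponential profiles *)

(** Since [Qm], [Qp] and the sought eigenvalue are real, an eigenfunction with real components
    suffices; this embeds real vectors into [C2]. *)
Definition emb (x y : R) : C2 := (RtoC x, RtoC y).

(** One exponential per eigenvector of the matrix on a half-line. The family is closed under
    differentiation, which gives both the equations and smoothness of all orders. *)
Definition modes {V : NormedModule R_AbsRing} (k1 k2 : R) (c1 c2 : V)
    (xi : R) : V :=
  plus (scal (exp (k1 * xi)) c1) (scal (exp (k2 * xi)) c2).

Lemma is_derive_modes {V : NormedModule R_AbsRing} (k1 k2 : R) (c1 c2 : V)
    (xi : R) :
  is_derive (modes k1 k2 c1 c2) xi
    (modes k1 k2 (scal k1 c1) (scal k2 c2) xi).
Proof.
assert (E : forall k, is_derive (fun x => exp (k * x)) xi (exp (k * xi) * k)).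
{ intros k; auto_derive; [exact I | ring]. }
unfold modes; rewrite !scal_assoc.
apply (is_derive_plus (V := V)); apply (is_derive_scal_l (V := V)); apply E.
Qed.

Lemma continuous_modes {V : NormedModule R_AbsRing} (k1 k2 : R) (c1 c2 : V)
    (xi : R) :
  continuous (modes k1 k2 c1 c2) xi.
Proof.
apply (ex_derive_continuous (V := V)); eexists; apply is_derive_modes.
Qed.

Lemma modes_0 {V : NormedModule R_AbsRing} (k1 k2 : R) (c1 c2 : V) :
  modes k1 k2 c1 c2 0 = plus c1 c2.
Proof.
unfold modes; rewrite !Rmult_0_r, exp_0.
f_equal; apply (scal_one (K := R_AbsRing)).
Qed.

Lemma smooth_modes {V : NormedModule R_AbsRing} (I : R -> Prop) (g : R -> V)
    (k1 k2 : R) (c1 c2 : V) :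
  (forall x, I x -> g x = modes k1 k2 c1 c2 x) -> smooth_up_to_zero I g.
Proof.
intros Hg.
exists (fun n => modes k1 k2 (scal (k1 ^ n) c1) (scal (k2 ^ n) c2)).
split; [|split].
- intros x Ix; rewrite (Hg x Ix); simpl.
  change 1 with (one (K := R_AbsRing)); now rewrite !scal_one.
- intros n x _; simpl.
  change (k1 * k1 ^ n) with (mult k1 (k1 ^ n)).
  change (k2 * k2 ^ n) with (mult k2 (k2 ^ n)).
  rewrite <- !scal_assoc; apply is_derive_modes.
- intros n; eexists.
  eapply filterlim_filter_le_1; [apply filter_le_within|].
  apply continuous_modes.
Qed.

Lemma modes_within_0 {V : NormedModule R_AbsRing} (I : R -> Prop) (g : R -> V)
    (k1 k2 : R) (c1 c2 : V) :
  (forall x, I x -> g x = modes k1 k2 c1 c2 x) ->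
  filterlim g (within I (locally 0)) (locally (plus c1 c2)).
Proof.
intros Hg; rewrite <- (modes_0 k1 k2).
apply (filterlim_within_ext I (modes k1 k2 c1 c2)).
  now intros x Ix; symmetry; apply Hg.
eapply filterlim_filter_le_1; [apply filter_le_within|].
apply continuous_modes.
Qed.

(** A general filter lets one argument serve both ends: positive rates at -oo, negative rates at
    +oo. *)
Lemma modes_decay {V : NormedModule R_AbsRing} (F : (R -> Prop) -> Prop)
    {FF : Filter F} (g : R -> V) (k1 k2 : R) (c1 c2 : V) :
  F (fun x => g x = modes k1 k2 c1 c2 x) ->
  filterlim (fun x => k1 * x) F (Rbar_locally m_infty) ->
  filterlim (fun x => k2 * x) F (Rbar_locally m_infty) ->
  filterlim g F (locally (zero : V)).
Proof.
intros Hg H1 H2.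
apply (filterlim_ext_loc (modes k1 k2 c1 c2)).
  now revert Hg; apply filter_imp.
assert (E : forall k (c : V), filterlim (fun x => k * x) F (Rbar_locally m_infty) ->
  filterlim (fun x => scal (exp (k * x)) c) F (locally (zero : V))).
{ intros k c Hk; replace (zero : V) with (scal (zero : R_AbsRing) c) by exact (@scal_zero_l R_AbsRing V c).
  apply (filterlim_comp _ _ _ (fun x => exp (k * x)) (fun e => scal e c) F
    (locally (zero : R_AbsRing))); [|apply (filterlim_scal_l (V := V))].
  apply (filterlim_comp _ _ _ (fun x => k * x) exp F (Rbar_locally m_infty));
    [exact Hk | exact is_lim_exp_m]. }
replace (zero : V) with (plus (zero : V) zero) by exact (plus_zero_l (G := V) zero).
unfold modes; eapply filterlim_comp_2; [| | apply (filterlim_plus (V := V))];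
  apply E; assumption.
Qed.

Lemma mult_m_infty_pos (k : R) :
  0 < k -> filterlim (fun x => k * x) (Rbar_locally m_infty) (Rbar_locally m_infty).
Proof.
intros Hk P [M HM]; exists (M / k); intros x Hx; apply HM.
apply (Rmult_lt_compat_l k) in Hx; [|exact Hk].
replace (k * (M / k)) with M in Hx; [exact Hx | field; lra].
Qed.

Lemma mult_p_infty_neg (k : R) :
  k < 0 -> filterlim (fun x => k * x) (Rbar_locally p_infty) (Rbar_locally m_infty).
Proof.
intros Hk P [M HM]; exists (M / k); intros x Hx; apply HM.
apply (Rmult_lt_gt_compat_neg_l k) in Hx; [|exact Hk].
replace (k * (M / k)) with M in Hx; [exact Hx | field; lra].
Qed.

(** * Vector operations in real coordinates *)

Lemma emb_inj (x y x' y' : R) : emb x y = emb x' y' -> x = x' /\ y = y'.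
Proof. intros H; injection H; auto. Qed.

Ltac C2_ring :=
  apply injective_projections; apply injective_projections; simpl;
  unfold scal, plus, opp; simpl; unfold mult; simpl; ring.

Lemma plus_emb (x y x' y' : R) :
  plus (emb x y) (emb x' y') = emb (x + x') (y + y').
Proof. C2_ring. Qed.

Lemma scal_emb (r x y : R) : scal r (emb x y) = emb (r * x) (r * y).
Proof. C2_ring. Qed.

Lemma mulsv_emb (a b c x y : R) :
  mulsv (Sym2 a b c) (emb x y) = emb (a * x + c * y) (c * x + b * y).
Proof. C2_ring. Qed.

Lemma modes_emb (k1 k2 x1 y1 x2 y2 xi : R) :
  modes k1 k2 (emb x1 y1) (emb x2 y2) xi =
  emb (exp (k1 * xi) * x1 + exp (k2 * xi) * x2)
    (exp (k1 * xi) * y1 + exp (k2 * xi) * y2).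
Proof. unfold modes; now rewrite !scal_emb, plus_emb. Qed.

(** The vector [e] for which the jump matrix is S = 1 + e n^T. *)
Definition jump_dir (fm fp : R2) : R * R :=
  ((fst fp - fst fm) / snd fm, (snd fp - snd fm) / snd fm).

Lemma jump_emb (fm fp : R2) (x y : R) :
  jump fm fp (emb x y) =
  emb (x + fst (jump_dir fm fp) * y) (y + snd (jump_dir fm fp) * y).
Proof.
assert (E : dot (V := R_NormedModule) fm normal = snd fm).
{ unfold dot, normal, scal, plus; simpl; unfold mult; simpl; ring. }
unfold jump; rewrite E; unfold dir, dot, minus, jump_dir, Rdiv.
destruct fm, fp; C2_ring.
Qed.

(** * Eigenfunctions from matching data at 0 *)

(** On an eigenvector with eigenvalue q, take z = (lam / k) v with v proportional to exp (k xi).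
    Then z' = lam v, and v' = q v + z reduces to k = q + lam / k, the quadratic equation for k. *)
Lemma spectral_ode_modes (q1 q2 x y lam k1 k2 m1 m2 : R) (v z : R -> C2)
    (xi : R) :
  x ^ 2 + y ^ 2 = 1 ->
  k1 <> 0 -> k2 <> 0 -> k1 ^ 2 = q1 * k1 + lam -> k2 ^ 2 = q2 * k2 + lam ->
  locally xi (fun t => v t =
    modes k1 k2 (emb (m1 * x) (m1 * y)) (emb (- m2 * y) (m2 * x)) t) ->
  locally xi (fun t => z t =
    modes k1 k2 (emb (lam / k1 * (m1 * x)) (lam / k1 * (m1 * y)))
      (emb (lam / k2 * (- m2 * y)) (lam / k2 * (m2 * x))) t) ->
  spectral_ode (spec q1 q2 x y) (RtoC lam) v z xi.
Proof.
intros Hxy Hk1 Hk2 E1 E2 Hv Hz.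
assert (F1 : k1 = q1 + lam / k1) by (field_simplify_eq; lra).
assert (F2 : k2 = q2 + lam / k2) by (field_simplify_eq; lra).
assert (Hy : y ^ 2 = 1 - x ^ 2) by lra.
split.
- apply (is_derive_ext_loc
    (modes k1 k2 (emb (m1 * x) (m1 * y)) (emb (- m2 * y) (m2 * x)))).
    now revert Hv; apply filter_imp.
  rewrite (locally_singleton _ _ Hv), (locally_singleton _ _ Hz).
  evar_last; [apply is_derive_modes|].
  rewrite !scal_emb, !modes_emb; unfold spec.
  rewrite mulsv_emb, plus_emb.
  generalize (lam / k1) (lam / k2) (exp (k1 * xi)) (exp (k2 * xi)) F1 F2.
  intros l1 l2 e1 e2 G1 G2; f_equal; ring [Hy G1 G2].
- apply (is_derive_ext_loc
    (modes k1 k2 (emb (lam / k1 * (m1 * x)) (lam / k1 * (m1 * y)))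
      (emb (lam / k2 * (- m2 * y)) (lam / k2 * (m2 * x))))).
    now revert Hz; apply filter_imp.
  rewrite (locally_singleton _ _ Hv).
  evar_last; [apply is_derive_modes|].
  rewrite !scal_emb, !modes_emb; unfold emb; simpl.
  rewrite <- !RtoC_mult; f_equal; f_equal; field; auto.
Qed.

(** The [m] and [n] are the coordinates of v(-0) and v(+0) in the eigenbases of [Qm] and [Qp]. The
    last two hypotheses express continuity of z at 0 with the factor [lam] divided out. *)
Lemma is_eigenvalue_modes (q1 q2 x y r1 r2 x' y' lam k1 k2 l1 l2 : R)
    (m1 m2 n1 n2 : R) (um up w : R2) :
  let Qm := spec q1 q2 x y in
  let Qp := spec r1 r2 x' y' in
  x ^ 2 + y ^ 2 = 1 -> x' ^ 2 + y' ^ 2 = 1 ->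
  0 < k1 -> 0 < k2 -> l1 < 0 -> l2 < 0 ->
  k1 ^ 2 = q1 * k1 + lam -> k2 ^ 2 = q2 * k2 + lam ->
  l1 ^ 2 = r1 * l1 + lam -> l2 ^ 2 = r2 * l2 + lam ->
  m1 * x - m2 * y <> 0 \/ m1 * y + m2 * x <> 0 ->
  jump (affine_field Qm um w) (affine_field Qp up w)
    (emb (m1 * x - m2 * y) (m1 * y + m2 * x)) =
  emb (n1 * x' - n2 * y') (n1 * y' + n2 * x') ->
  m1 / k1 * x - m2 / k2 * y = n1 / l1 * x' - n2 / l2 * y' ->
  m1 / k1 * y + m2 / k2 * x = n1 / l1 * y' + n2 / l2 * x' ->
  is_eigenvalue Qm Qp um up w (RtoC lam).
Proof.
intros Qm Qp Hxy Hxy' Hk1 Hk2 Hl1 Hl2 Ek1 Ek2 El1 El2 Hm HS Hz1 Hz2.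
set (vm := modes k1 k2 (emb (m1 * x) (m1 * y)) (emb (- m2 * y) (m2 * x))).
set (vp := modes l1 l2 (emb (n1 * x') (n1 * y')) (emb (- n2 * y') (n2 * x'))).
set (zm := modes k1 k2 (emb (lam / k1 * (m1 * x)) (lam / k1 * (m1 * y)))
  (emb (lam / k2 * (- m2 * y)) (lam / k2 * (m2 * x)))).
set (zp := modes l1 l2 (emb (lam / l1 * (n1 * x')) (lam / l1 * (n1 * y')))
  (emb (lam / l2 * (- n2 * y')) (lam / l2 * (n2 * x')))).
set (glue := fun (f g : R -> C2) xi => if Rlt_dec xi 0 then f xi else g xi).
assert (Gm : forall f g xi, xi < 0 -> glue f g xi = f xi).
{ intros f g xi H; unfold glue; destruct (Rlt_dec xi 0); [auto | lra]. }
assert (Gp : forall f g xi, 0 < xi -> glue f g xi = g xi).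
{ intros f g xi H; unfold glue; destruct (Rlt_dec xi 0); [lra | auto]. }
assert (Lm : forall f g xi, xi < 0 -> locally xi (fun t => glue f g t = f t)).
{ intros f g xi H; generalize (open_lt 0 xi H); apply filter_imp; auto. }
assert (Lp : forall f g xi, 0 < xi -> locally xi (fun t => glue f g t = g t)).
{ intros f g xi H; generalize (open_gt 0 xi H); apply filter_imp; auto. }
assert (Im : forall f g, Rbar_locally m_infty (fun t => glue f g t = f t)).
{ intros f g; exists 0; auto. }
assert (Ip : forall f g, Rbar_locally p_infty (fun t => glue f g t = g t)).
{ intros f g; exists 0; auto. }
exists (glue vm vp), (glue zm zp).
repeat match goal with |- _ /\ _ => split end.
(* Any negative point would do: exponentials never vanish, and projecting v = 0 onto the orthonormal
   vectors [(x, y)] and [(-y, x)] would force [m1 = m2 = 0]. *)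
- exists (-1); split; [lra | left; intros H].
  rewrite Gm in H by lra; unfold vm in H; rewrite modes_emb in H.
  change (emb 0 0) with (zero : C2) in H.
  apply (emb_inj _ _ 0 0) in H; destruct H as [Hx Hy].
  assert (P1 := exp_pos (k1 * -1)); assert (P2 := exp_pos (k2 * -1)).
  assert (M1 : exp (k1 * -1) * m1 = 0).
  { apply (f_equal (Rmult x)) in Hx; apply (f_equal (Rmult y)) in Hy.
    rewrite <- (Rmult_1_r (_ * m1)), <- Hxy; lra. }
  assert (M2 : exp (k2 * -1) * m2 = 0).
  { apply (f_equal (Rmult y)) in Hx; apply (f_equal (Rmult x)) in Hy.
    rewrite <- (Rmult_1_r (_ * m2)), <- Hxy; lra. }
  assert (m1 = 0) by (apply Rmult_integral in M1; lra).
  assert (m2 = 0) by (apply Rmult_integral in M2; lra).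
  subst m1 m2; lra.
- eapply smooth_modes; apply Gm.
- eapply smooth_modes; apply Gp.
- eapply smooth_modes; apply Gm.
- eapply smooth_modes; apply Gp.
- intros xi H; apply (spectral_ode_modes q1 q2 x y lam k1 k2 m1 m2);
    try apply Lm; auto; lra.
- intros xi H; apply (spectral_ode_modes r1 r2 x' y' lam l1 l2 n1 n2);
    try apply Lp; auto; lra.
- exists (emb (m1 * x - m2 * y) (m1 * y + m2 * x)); rewrite HS; split.
  + replace (emb _ _) with (plus (emb (m1 * x) (m1 * y)) (emb (- m2 * y) (m2 * x)))
      by (rewrite plus_emb; f_equal; ring).
    apply (modes_within_0 _ _ k1 k2), Gm.
  + replace (emb _ _) with
      (plus (emb (n1 * x') (n1 * y')) (emb (- n2 * y') (n2 * x')))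
      by (rewrite plus_emb; f_equal; ring).
    apply (modes_within_0 _ _ l1 l2), Gp.
- eexists; split.
  + apply (modes_within_0 _ _ k1 k2), Gm.
  + rewrite plus_emb.
    replace (emb _ _) with
      (plus (emb (lam / l1 * (n1 * x')) (lam / l1 * (n1 * y')))
        (emb (lam / l2 * (- n2 * y')) (lam / l2 * (n2 * x')))).
    * apply (modes_within_0 _ _ l1 l2), Gp.
    * apply (f_equal (Rmult lam)) in Hz1; apply (f_equal (Rmult lam)) in Hz2.
      rewrite plus_emb; f_equal; unfold Rdiv in *; lra.
- apply (modes_decay _ _ _ _ _ _ (Im _ _)); apply mult_m_infty_pos; assumption.
- apply (modes_decay _ _ _ _ _ _ (Ip _ _)); apply mult_p_infty_neg; assumption.
- apply (modes_decay _ _ _ _ _ _ (Im _ _)); apply mult_m_infty_pos; assumption.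
- apply (modes_decay _ _ _ _ _ _ (Ip _ _)); apply mult_p_infty_neg; assumption.
Qed.

(** * The Evans determinant: its value at lam = 0 and the meaning of its roots *)

Lemma rate_scaled_eq (q t : R) :
  0 < q -> t < 1 ->
  (rate q t / (1 - t)) ^ 2 = q * (rate q t / (1 - t)) + (t / (1 - t)) ^ 2.
Proof.
intros Hq Ht; assert (H := rate_eq q t Hq).
field_simplify_eq; [rewrite H; ring | lra].
Qed.

(** Two forms of the inverse matrix: inverted eigenvalues, and adjugate over determinant. *)
Lemma spec_inv (q1 q2 x y : R) :
  x ^ 2 + y ^ 2 = 1 -> q1 <> 0 -> q2 <> 0 ->
  let Q := spec q1 q2 x y in
  spec (/ q1) (/ q2) x y =
  Sym2 (ent_b Q / det Q) (ent_a Q / det Q) (- ent_c Q / det Q).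
Proof.
intros H H1 H2 Q; unfold Q; rewrite (det_spec _ _ _ _ H).
unfold spec; simpl ent_a; simpl ent_b; simpl ent_c.
f_equal; field; auto.
Qed.

Lemma spec_opp (q1 q2 x y : R) :
  spec (- q1) (- q2) x y =
  let Q := spec q1 q2 x y in Sym2 (- ent_a Q) (- ent_b Q) (- ent_c Q).
Proof. unfold spec; simpl; f_equal; ring. Qed.

(** The determinant of [H1 + H2 (1 + e n^T)], with [n = (0, 1)]. *)
Definition evans (H1 H2 : sym2) (e : R * R) : R :=
  (ent_a H1 + ent_a H2) *
    (ent_b H1 + (ent_c H2 * fst e + ent_b H2 * (1 + snd e))) -
  (ent_c H1 + (ent_a H2 * fst e + ent_c H2 * (1 + snd e))) *
    (ent_c H1 + ent_c H2).

(** The two matrices are Q_-^-1 and -Q_+^-1. As S maps f^- to f^+, the matrix Q_-^-1 - Q_+^-1 S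
    sends f^- to u^+ - u^-, in which [s] has cancelled. S also fixes (1, 0), so evaluating the
    determinant on the pair (1, 0), f^- yields [Lambda], up to the positive or negative factors in
    the denominator. *)
Lemma evans_at_0 (Qm Qp : sym2) (um up : R2) (s : R) :
  det Qm <> 0 -> det Qp <> 0 -> snd (affine_field Qm um (s, 0)) <> 0 ->
  evans (Sym2 (ent_b Qm / det Qm) (ent_a Qm / det Qm) (- ent_c Qm / det Qm))
    (Sym2 (- ent_b Qp / det Qp) (- ent_a Qp / det Qp) (ent_c Qp / det Qp))
    (jump_dir (affine_field Qm um (s, 0)) (affine_field Qp up (s, 0))) =
  Lambda Qm Qp um up / (det Qm * det Qp * snd (affine_field Qm um (s, 0))).
Proof.
destruct Qm as [a b c], Qp as [a' b' c'], um as [u1 u2], up as [v1 v2].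
unfold evans, jump_dir, affine_field, mulsv, Lambda, Defs.A1, A2, det, minus; simpl.
unfold plus, scal, opp; simpl; unfold mult; simpl.
intros H1 H2 H3; rewrite ?Rmult_1_r, ?Rplus_0_l in *; field; auto.
Qed.

(** A kernel vector of the Evans matrix serves as v(-0). The matrices built from reciprocal rates
    are K_-^-1 and -K_+^-1 divided by [1 - t], so the kernel equation is exactly the matching of
    z. *)
Lemma eigenvalue_of_evans_root (q1 q2 x y r1 r2 x' y' t : R)
    (um up w : R2) :
  let Qm := spec q1 q2 x y in
  let Qp := spec r1 r2 x' y' in
  x ^ 2 + y ^ 2 = 1 -> x' ^ 2 + y' ^ 2 = 1 ->
  0 < q1 -> 0 < q2 -> r1 < 0 -> r2 < 0 -> 0 < t < 1 ->
  evans (spec (/ rate q1 t) (/ rate q2 t) x y)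
    (spec (/ rate (- r1) t) (/ rate (- r2) t) x' y')
    (jump_dir (affine_field Qm um w) (affine_field Qp up w)) = 0 ->
  is_eigenvalue Qm Qp um up w (RtoC ((t / (1 - t)) ^ 2)).
Proof.
intros Qm Qp Hxy Hxy' Hq1 Hq2 Hr1 Hr2 [Ht0 Ht1] Hev.
assert (HJ := jump_emb (affine_field Qm um w) (affine_field Qp up w)).
destruct (jump_dir _ _) as [e1 e2]; unfold evans in Hev.
destruct (singular_kernel _ _ _ _ Hev) as (p1 & p2 & Hp & E1 & E2).
simpl in E1, E2, HJ.
(* [(s1, s2)] is S applied to the kernel vector, hence v(+0). *)
set (s1 := p1 + e1 * p2); set (s2 := p2 + e2 * p2).
assert (P1 := rate_pos q1 t Hq1); assert (P2 := rate_pos q2 t Hq2).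
assert (P3 := rate_pos (- r1) t ltac:(lra)).
assert (P4 := rate_pos (- r2) t ltac:(lra)).
assert (Ht : 0 < / (1 - t)) by (apply Rinv_0_lt_compat; lra).
assert (R3 := rate_scaled_eq (- r1) t ltac:(lra) Ht1).
assert (R4 := rate_scaled_eq (- r2) t ltac:(lra) Ht1).
assert (U : forall a b u v, u ^ 2 + v ^ 2 = 1 ->
  (u * a + v * b) * u - (u * b - v * a) * v = a /\
  (u * a + v * b) * v + (u * b - v * a) * u = b).
{ intros a b u v Huv; assert (Hv : v ^ 2 = 1 - u ^ 2) by lra.
  split; ring [Hv]. }
destruct (U p1 p2 x y Hxy) as [Up1 Up2].
destruct (U s1 s2 x' y' Hxy') as [Us1 Us2].
(* Changing the sign of both eigenvalue and rate preserves k^2 = q k + lam, so the negative rates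
   for [Qp] come from the positive ones for [- r1] and [- r2]. The coefficients are the eigenbasis
   coordinates of the vectors [p] and [s]. *)
apply (is_eigenvalue_modes q1 q2 x y r1 r2 x' y' _
  (rate q1 t / (1 - t)) (rate q2 t / (1 - t))
  (- (rate (- r1) t / (1 - t))) (- (rate (- r2) t / (1 - t)))
  (x * p1 + y * p2) (x * p2 - y * p1)
  (x' * s1 + y' * s2) (x' * s2 - y' * s1)); auto.
- apply Rmult_lt_0_compat; auto.
- apply Rmult_lt_0_compat; auto.
- apply Ropp_lt_gt_0_contravar, Rmult_lt_0_compat; auto.
- apply Ropp_lt_gt_0_contravar, Rmult_lt_0_compat; auto.
- now apply rate_scaled_eq.
- now apply rate_scaled_eq.
- lra.
- lra.
- rewrite Up1, Up2; exact Hp.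
- rewrite Up1, Up2, Us1, Us2; apply HJ.
- apply (Rmult_eq_reg_r (/ (1 - t))); [|lra].
  apply Rminus_diag_uniq; rewrite <- E1 at 1; unfold s1, s2; field; lra.
- apply (Rmult_eq_reg_r (/ (1 - t))); [|lra].
  apply Rminus_diag_uniq; rewrite <- E2 at 1; unfold s1, s2; field; lra.
Qed.

(** * Sign change of the Evans determinant *)

Theorem corollary4p1 (Qm Qp : sym2) (um up : R2)
  (hup : 0 < snd up) (hum : snd um < 0)
  (ham : 0 < ent_a Qm) (hbm : 0 < ent_b Qm)
  (hap : ent_a Qp < 0) (hbp : ent_b Qp < 0)
  (hdm : 0 < det Qm) (hdp : 0 < det Qp)
  (hLambda : Lambda Qm Qp um up < 0)
  (gamma : R -> R2) (s : R)
  (hgamma : heteroclinic Qm Qp um up gamma)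
  (hcross : crosses_transversally Qm Qp um up gamma (s, 0)) :
  (exists lambda : R,
     0 < lambda /\ is_eigenvalue Qm Qp um up (s, 0) (RtoC lambda)) /\
  spectrally_unstable Qm Qp um up (s, 0).
Proof.
enough (Hreal : exists lambda : R,
    0 < lambda /\ is_eigenvalue Qm Qp um up (s, 0) (RtoC lambda)).
{ split; [exact Hreal|].
  destruct Hreal as (lam & Hlam & Heig); now exists (RtoC lam). }
destruct hcross as (_ & _ & _ & Hfm & Hfp).
destruct (sym2_diagonalization Qm) as (q1 & q2 & x & y & Hxy & EQm).
destruct (sym2_diagonalization Qp) as (r1 & r2 & x' & y' & Hxy' & EQp).
assert (Hq : 0 < q1 /\ 0 < q2).
{ apply (spec_pos _ _ x y); rewrite <- ?EQm; auto. }
assert (Hr : 0 < - r1 /\ 0 < - r2).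
{ apply (spec_pos _ _ x' y'); auto; rewrite spec_opp, <- EQp; cbv zeta.
  - simpl; lra.
  - unfold det in *; simpl in *; lra. }
destruct Hq as [Hq1 Hq2], Hr as [Hr1 Hr2].
set (e := jump_dir (affine_field Qm um (s, 0)) (affine_field Qp up (s, 0))).
set (G := fun t => evans (spec (/ rate q1 t) (/ rate q2 t) x y)
    (spec (/ rate (- r1) t) (/ rate (- r2) t) x' y') e).
(* At [t = 0] the rates are the eigenvalues of [Qm] and of -Q_+, which leaves [Lambda] over a
   positive number. *)
assert (G0 : G 0 < 0).
{ unfold G; rewrite !rate_0 by auto.
  rewrite !spec_inv, spec_opp, <- EQm, <- EQp by (auto; lra); cbv zeta.
  replace (det (Sym2 _ _ _)) with (det Qp)
    by (unfold det; simpl; ring).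
  simpl; rewrite Ropp_involutive; unfold e; rewrite evans_at_0 by lra.
  apply Rdiv_neg_pos; [exact hLambda|].
  repeat apply Rmult_lt_0_compat; auto. }
(* At [t = 1] both matrices are the identity and the determinant is [2 * (2 + snd e)]; here
   [1 + snd e] is the ratio of the normal components of f^+ and f^-, positive by transversality. *)
assert (G1 : 0 < G 1).
{ unfold G; rewrite !rate_1, !spec_same, Rinv_1 by auto.
  assert (He : 0 < 1 + snd e).
  { unfold e, jump_dir; cbn [snd].
    revert Hfm Hfp; generalize (snd (affine_field Qm um (s, 0))).
    generalize (snd (affine_field Qp up (s, 0))); intros fp2 fm2 Hfm Hfp.
    replace (1 + (fp2 - fm2) / fm2) with (fp2 / fm2) by (field; lra).
    now apply Rdiv_lt_0_compat. }
  revert He; generalize e; intros [e1 e2]; unfold evans; simpl; lra. }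
assert (Gc : continuity G).
{ intros t; apply continuity_pt_filterlim.
  apply (ex_derive_continuous (V := R_NormedModule)).
  (* With the reciprocal rates made opaque, [G] is a polynomial in four differentiable functions. *)
  set (h1 := fun t => / rate q1 t); set (h2 := fun t => / rate q2 t).
  set (h3 := fun t => / rate (- r1) t); set (h4 := fun t => / rate (- r2) t).
  assert (D1 : ex_derive h1 t) by now apply ex_derive_inv_rate.
  assert (D2 : ex_derive h2 t) by now apply ex_derive_inv_rate.
  assert (D3 : ex_derive h3 t) by now apply ex_derive_inv_rate.
  assert (D4 : ex_derive h4 t) by now apply ex_derive_inv_rate.
  change (ex_derive (fun t =>
    (h1 t * x ^ 2 + h2 t * y ^ 2 + (h3 t * x' ^ 2 + h4 t * y' ^ 2)) *
    (h1 t * y ^ 2 + h2 t * x ^ 2 + ((h3 t - h4 t) * x' * y' * fst e +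
       (h3 t * y' ^ 2 + h4 t * x' ^ 2) * (1 + snd e))) -
    ((h1 t - h2 t) * x * y + ((h3 t * x' ^ 2 + h4 t * y' ^ 2) * fst e +
       (h3 t - h4 t) * x' * y' * (1 + snd e))) *
    ((h1 t - h2 t) * x * y + (h3 t - h4 t) * x' * y')) t).
  clearbody h1 h2 h3 h4; auto_derive; repeat split; assumption. }
destruct (IVT G 0 1 Gc Rlt_0_1 G0 G1) as [t [[Ht0 Ht1] Gt]].
(* The root is interior because [G] is nonzero at both ends; this makes [lam] positive and
   finite. *)
assert (t <> 0) by (intros ->; lra).
assert (t <> 1) by (intros ->; lra).
exists ((t / (1 - t)) ^ 2); split.
- apply pow_lt, Rdiv_lt_0_compat; lra.
- unfold G, e in Gt; rewrite EQm, EQp in Gt |- *.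
  apply eigenvalue_of_evans_root; auto; lra.
Qed.
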